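(* Let $X$ be a smooth projective curve over a finite field $\mathbb{F}_q$, with an action of $(\mathbb{Z}/2\mathbb{Z})^r$, and let $B=\{b_1,\ldots,b_r\}$ be a basis of $(\mathbb{Z}/2\mathbb{Z})^r$. For all subsets $K$ of $(\mathbb{Z}/2\mathbb{Z})^r$ and all non-negative integers $s\le r$, we have $$\#(X/\langle\{b_1+\cdots+b_s\}\cup K\rangle)(\mathbb{F}_q)=\tfrac{1+(-1)^s}{2}\,\#(X/\langle K\rangle)(\mathbb{F}_q)+(-1)^{s+1}\sum_{j=1}^s(-2)^{j-1}\sum_{\substack{I\subseteq\{b_1,\ldots,b_s\}\\ \#I=j}}\#(X/\langle I\cup K\rangle)(\mathbb{F}_q).$$ Moreover, given $I$ a subset of $(\mathbb{Z}/2\mathbb{Z})^r$, the number $\#(X/\langle I\rangle)(\mathbb{F}_q)$ can be written as an integral linear combination of the numbers $\#(X/\langle S\rangle)(\mathbb{F}_q)$ with $S$ varying among all the subsets of $B$.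
   Context: Curves are absolutely irreducible, and the group acts by automorphisms of the curve defined over $\mathbb{F}_q$. For a subset $I$ of $(\mathbb{Z}/2\mathbb{Z})^r$, $\langle I\rangle$ denotes the subgroup generated by $I$, and $X/\langle I\rangle$ the corresponding quotient curve. For $s=0$, the empty sum $b_1+\cdots+b_s$ is $0$. *)

(* Defs.v *)
From mathcomp Require Import all_boot all_order all_algebra all_fingroup.
From mathcomp.multinomials Require Import mpoly.

Set Implicit Arguments.
Unset Strict Implicit.
Unset Printing Implicit Defensive.
Import GRing.Theory.
Local Open Scope ring_scope.

(* Points of P^n over a field E are the lines of E^(n+1).  All the polynomials
   evaluated below are homogeneous, so the choice of the spanning vector
   [vpick P] of a line P does not affect the vanishing of such a value, nor a
   ratio of two values of the same degree. *)
Definition hcoord (E : fieldType) n (P : {vspace 'rV[E]_n.+1}) : 'I_n.+1 -> E :=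
  vpick P 0.

Definition peval (F E : fieldType) (j : {rmorphism F -> E}) n
    (f : {mpoly F[n.+1]}) (P : {vspace 'rV[E]_n.+1}) : E :=
  (map_mpoly j f).@[hcoord P].

Definition homogeneous (F : fieldType) n (f : {mpoly F[n]}) : Prop :=
  exists d, f \is d.-homog.

(* The closed subscheme of P^n over k cut out by [eqs]. *)
Record projScheme (k : fieldType) := ProjScheme {
  ambient : nat;
  eqs : seq {mpoly k[ambient.+1]};
  eqs_homog : {in eqs, forall f, homogeneous f} }.

Definition on_scheme (k : fieldType) (X : projScheme k) (E : fieldType)
    (j : {rmorphism k -> E}) (P : {vspace 'rV[E]_(ambient X).+1}) : bool :=
  (\dim P == 1%N) && all (fun f => peval j f P == 0) (eqs X).
Arguments on_scheme {k} X {E} j P.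

(* X(E), for an extension j : k -> E. *)
Definition points (k : fieldType) (X : projScheme k) (E : fieldType)
    (j : {rmorphism k -> E}) := {P | on_scheme X j P}.

(* #X(k) *)
Definition npoints (k : finFieldType) (X : projScheme k) : nat :=
  size (undup [seq P <- [seq <[v]>%VS | v : 'rV[k]_(ambient X).+1]
              | on_scheme X (idfun : {rmorphism k -> k}) P]).

Section Zariski.
Variables (k L : fieldType) (iota : {rmorphism k -> L}) (X : projScheme k).
Local Notation pts := (points X iota).
Implicit Types (Z U W : pts -> Prop).

(* Closed and open subsets of X(L) defined by polynomials over F: used with
   F = L (geometric Zariski topology) and F = k (topology of X over k). *)
Definition zclosed (F : fieldType) (j : {rmorphism F -> L}) Z : Prop :=
  exists2 fs : seq {mpoly F[(ambient X).+1]},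
    {in fs, forall f, homogeneous f} &
    forall P, Z P <-> {in fs, forall f, peval j f (val P) = 0}.

Definition zopen (F : fieldType) (j : {rmorphism F -> L}) U : Prop :=
  exists2 Z, zclosed j Z & forall P, U P <-> ~ Z P.

Definition geom_closed : (pts -> Prop) -> Prop :=
  zclosed (idfun : {rmorphism L -> L}).
Definition geom_open : (pts -> Prop) -> Prop :=
  zopen (idfun : {rmorphism L -> L}).

Definition irreducible_set Z : Prop :=
  (exists P, Z P) /\
  forall Z1 Z2, geom_closed Z1 -> geom_closed Z2 ->
    (forall P, Z P -> Z1 P \/ Z2 P) ->
    (forall P, Z P -> Z1 P) \/ (forall P, Z P -> Z2 P).

Definition irreducible_chain (m : nat) : Prop :=
  exists Z : nat -> pts -> Prop,
    (forall i, (i <= m)%N -> geom_closed (Z i) /\ irreducible_set (Z i)) /\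
    (forall i, (i < m)%N ->
       (forall P, Z i P -> Z i.+1 P) /\ exists2 P, Z i.+1 P & ~ Z i P).

Definition has_dim (m : nat) : Prop :=
  irreducible_chain m /\ ~ irreducible_chain m.+1.

Definition jacobian (P : pts) : 'M[L]_(size (eqs X), (ambient X).+1) :=
  \matrix_(i, j) peval iota (eqs X)`_i^`M(j) (val P).

(* [f] is regular on U; its values outside U are irrelevant. *)
Definition regular_on U (f : pts -> L) : Prop :=
  forall P, U P -> exists W (d : nat) (g h : {mpoly L[(ambient X).+1]}),
    [/\ geom_open W, W P, g \is d.-homog, h \is d.-homog &
      forall Q, W Q -> U Q ->
        peval (idfun : {rmorphism L -> L}) h (val Q) != 0 /\
        f Q = peval (idfun : {rmorphism L -> L}) g (val Q) /
              peval (idfun : {rmorphism L -> L}) h (val Q)].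

End Zariski.

(* A morphism X -> Y defined over k, through its action on L-points: locally for
   the Zariski topology of X over k, it is given by homogeneous polynomials over
   k of the same degree without common zero. *)
Definition morphism_over (k L : fieldType) (iota : {rmorphism k -> L})
    (X Y : projScheme k) (phi : points X iota -> points Y iota) : Prop :=
  forall P, exists (W : points X iota -> Prop) (d : nat)
      (g : 'I_(ambient Y).+1 -> {mpoly k[(ambient X).+1]}),
    [/\ zopen iota W, W P, forall i, g i \is d.-homog &
      forall Q, W Q ->
        let v := \row_i peval iota (g i) (val Q) in
        v != 0 /\ val (phi Q) = <[v]>%VS].

(* Smooth projective absolutely irreducible curves over k, L being an algebraic
   closure of k.  The last field is the Jacobian criterion in P^n; it applies to
   the scheme cut out by [eqs], so that [eqs] is locally a system of generators
   of the ideal of the curve. *)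
Record curve (k L : fieldType) (iota : {rmorphism k -> L}) := Curve {
  curve_scheme :> projScheme k;
  curve_irreducible :
    irreducible_set (fun _ : points curve_scheme iota => True);
  curve_dim : has_dim iota curve_scheme 1;
  curve_smooth : forall P : points curve_scheme iota,
    (\rank (jacobian P) + 1 = ambient curve_scheme)%N }.

Definition cpoints (k L : fieldType) (iota : {rmorphism k -> L})
  (X : curve iota) := points X iota.

(* The quotient curve X/H: a curve Y with a morphism pi : X -> Y over k through
   which Y is the set of H-orbits of X, endowed with the quotient topology and
   with the sheaf of H-invariant regular functions (on H-stable open subsets
   pi^-1(U), H-invariant functions are those of the form f \o pi). *)
Record quotient_curve (k L : fieldType) (iota : {rmorphism k -> L})
    (X : curve iota) (gT : finGroupType) (to : {action gT &-> cpoints X})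
    (H : {group gT}) := QuotientCurve {
  quot :> curve iota;
  quot_map : cpoints X -> cpoints quot;
  quot_morphism : morphism_over quot_map;
  quot_surj : forall y, exists x, quot_map x = y;
  quot_orbits : forall x x',
    quot_map x = quot_map x' <-> exists2 h, h \in H & x' = to x h;
  quot_topology : forall Z : cpoints quot -> Prop,
    geom_closed Z <-> geom_closed (fun x => Z (quot_map x));
  quot_regular : forall (U : cpoints quot -> Prop) (f : cpoints quot -> L),
    geom_open U ->
    (regular_on U f <->
     regular_on (fun x => U (quot_map x)) (fun x => f (quot_map x))) }.

(* Main.v *)
From HB Require Import structures.
Require Import Defs.
From mathcomp Require Import all_boot all_order all_algebra all_fingroup.
From mathcomp Require Import all_field.
From mathcomp.multinomials Require Import mpoly.

Set Implicit Arguments.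
Unset Strict Implicit.
Unset Printing Implicit Defensive.
Import GRing.Theory Num.Theory.
Local Open Scope ring_scope.

(* Let F be the Frobenius of X(L).  The F_q-points of X/H are the H-orbits of
   X(L) stable under F, and counting the pairs (x, h) with h in H and F x = x.h
   shows that their number is the average over H of
   f(h) = #{x in X(L) | F x = x.h}.  By Fourier inversion on (Z/2)^r,
   #(X/<I>)(F_q) is thus the sum, over the characters trivial on I, of Fourier
   coefficients of f that do not depend on I.  The identity is therefore linear
   in the indicators [chi is trivial on I], for which it is the expansion of
   prod_(v in T) chi(v) = prod_(v in T) (2 [chi(v) = 1] - 1).  Its coefficients
   are integers, so applying it to the elements of I one at a time gives the
   second claim. *)

(** * The Frobenius map and rational points *)

Lemma meval_map_mpoly (F E : fieldType) (j : {rmorphism F -> E}) n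
    (f : {mpoly F[n]}) (v : 'I_n -> E) :
  (map_mpoly j f).@[v] = mmap j v f.
Proof.
rewrite /map_mpoly {1}/mmap raddf_sum /= /mmap; apply: eq_bigr => m _.
rewrite mevalM /= mevalC; congr (_ * _).
rewrite /mmap1 rmorph_prod; apply: eq_bigr => i _.
by rewrite rmorphXn /= mevalXU.
Qed.

Lemma rmorph_meval (F E E' : fieldType) (j : {rmorphism F -> E})
    (j' : {rmorphism F -> E'}) (tau : {rmorphism E -> E'}) n
    (f : {mpoly F[n]}) (v : 'I_n -> E) (w : 'I_n -> E') :
    (forall a, tau (j a) = j' a) -> (forall i, w i = tau (v i)) ->
  tau (map_mpoly j f).@[v] = (map_mpoly j' f).@[w].
Proof.
move=> tauj tauv; rewrite !meval_map_mpoly /mmap rmorph_sum.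
apply: eq_bigr => m _; rewrite rmorphM /= tauj /mmap1 rmorph_prod.
by congr (_ * _); apply: eq_bigr => i _; rewrite rmorphXn /= tauv.
Qed.

Lemma dhomog_mevalZ (F E : fieldType) (j : {rmorphism F -> E}) n d
    (f : {mpoly F[n]}) (c : E) (v w : 'I_n -> E) :
    f \is d.-homog -> (forall i, w i = c * v i) ->
  (map_mpoly j f).@[w] = c ^+ d * (map_mpoly j f).@[v].
Proof.
move=> /dhomogP fd wcv; rewrite !meval_map_mpoly /mmap mulr_sumr.
rewrite !big_seq; apply: eq_bigr => m mf.
rewrite mulrCA; congr (_ * _).
have <- : mdeg m = d by apply: fd.
rewrite mdegE expr_sum /mmap1 -big_split; apply: eq_bigr => i _ /=.
by rewrite wcv exprMn.
Qed.

(** * Projective points as lines, and their behaviour under field morphisms *)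

Lemma vline_eqP (E : fieldType) n (v w : 'rV[E]_n) : v != 0 ->
  reflect (exists2 c, c != 0 & w = c *: v) (<[v]>%VS == <[w]>%VS).
Proof.
move=> v0; apply: (iffP eqP) => [vw | [c c0 ->]].
  have: w \in <[v]>%VS by rewrite vw memv_line.
  case/vlineP => c def_w; exists c => //; apply: contraNneq v0 => c0.
  have: v \in <[w]>%VS by rewrite -vw memv_line.
  by rewrite def_w c0 scale0r => /vlineP[a ->]; rewrite scaler0.
apply/esym/eqP; rewrite eqEdim -memvE !dim_vline v0 scaler_eq0 (negPf c0) v0.
by rewrite memvZ ?memv_line.
Qed.

Lemma vline_vpick (E : fieldType) n (P : {vspace 'rV[E]_n}) : \dim P == 1%N ->
  vpick P != 0 /\ P = <[vpick P]>%VS.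
Proof.
move=> dP; have P0 : vpick P != 0 by rewrite vpick0 -dimv_eq0 (eqP dP).
split=> //; apply/esym/eqP; rewrite eqEdim -memvE memv_pick dim_vline P0.
by rewrite (eqP dP).
Qed.

Lemma vpick_vline (E : fieldType) n (v : 'rV[E]_n) : v != 0 ->
  exists2 c, c != 0 & vpick <[v]>%VS = c *: v.
Proof.
move=> v0; apply/(vline_eqP _ v0)/eqP.
by have [] // := @vline_vpick _ _ <[v]>%VS; rewrite dim_vline v0.
Qed.

(** [vpick] returns an uncontrolled multiple of [v]. By homogeneity the equations vanish on one
    exactly when they vanish on the other, so membership can be tested on any spanning vector. *)
Lemma on_scheme_vline (k E : fieldType) (X : projScheme k)
    (j : {rmorphism k -> E}) (v : 'rV[E]_(ambient X).+1) : v != 0 ->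
  on_scheme X j <[v]>%VS = all (fun f => (map_mpoly j f).@[v 0] == 0) (eqs X).
Proof.
move=> v0; rewrite /on_scheme dim_vline v0 eqxx /=; apply: eq_in_all => f fX.
have [c c0 def_w] := vpick_vline v0; have [d fd] := eqs_homog fX.
rewrite /peval (dhomog_mevalZ (d := d) (c := c) j (v := v 0)) //.
  by rewrite mulf_eq0 expf_eq0 (negPf c0) andbF.
by move=> i; rewrite /hcoord def_w mxE.
Qed.

(** The entrywise image of a line need not be a subspace, so the image of one spanning vector is
    taken and its span formed. It serves both for extension of scalars ([tau] = [iota]) and for
    Frobenius ([tau] = [sigma]). *)
Definition map_line (E E' : fieldType) (tau : {rmorphism E -> E'}) n
    (P : {vspace 'rV[E]_n}) : {vspace 'rV[E']_n} :=
  <[map_mx tau (vpick P)]>%VS.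

Section MapLine.
Variables (E E' : fieldType) (tau : {rmorphism E -> E'}).

Lemma map_line_vline n (v : 'rV[E]_n) :
  v != 0 -> map_line tau <[v]> = <[map_mx tau v]>%VS.
Proof.
move=> v0; have [c c0 def_w] := vpick_vline v0.
apply/esym/eqP/vline_eqP; first by rewrite map_mx_eq0.
by exists (tau c); rewrite ?fmorph_eq0 // def_w map_mxZ.
Qed.

(** The equations have coefficients in [k], so [tau] carries their values at [P] to their values at
    the image; being injective, it preserves and reflects vanishing. *)
Lemma on_scheme_map (k : fieldType) (X : projScheme k)
    (j : {rmorphism k -> E}) (j' : {rmorphism k -> E'}) P :
    (forall a, tau (j a) = j' a) -> \dim P == 1%N ->
  on_scheme X j' (map_line tau P) = on_scheme X j P.
Proof.
move=> tauj /vline_vpick[]; move: (vpick P) => v v0 ->.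
rewrite map_line_vline // !on_scheme_vline ?map_mx_eq0 //.
apply: eq_all => f /=.
rewrite -(@rmorph_meval _ _ _ j j' tau _ f (v 0)) ?fmorph_eq0 //.
by move=> i; rewrite mxE.
Qed.

Lemma map_line_inj n (P Q : {vspace 'rV[E]_n}) :
  \dim P == 1%N -> \dim Q == 1%N -> map_line tau P = map_line tau Q -> P = Q.
Proof.
move=> /vline_vpick[]; move: (vpick P) => v v0 ->.
move=> /vline_vpick[]; move: (vpick Q) => w w0 ->.
rewrite !map_line_vline // => /eqP/vline_eqP; rewrite map_mx_eq0.
move=> -[] // c c0 vw.
apply/eqP/vline_eqP => //; have /rV0Pn[i vi] := v0.
have /rowP/(_ i) := vw; rewrite !mxE => vwi.
(* Comparing one nonzero coordinate shows that the scalar comes from [E], so that the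
   proportionality descends. *)
have def_c : c = tau (w 0 i / v 0 i).
  by rewrite fmorph_div vwi mulfK // fmorph_eq0.
exists (w 0 i / v 0 i); first by rewrite -(fmorph_eq0 tau) -def_c.
by apply: (@map_mx_inj _ _ tau); rewrite vw def_c map_mxZ.
Qed.

End MapLine.

(** * Frobenius on points and its commutation with morphisms over [k] *)

Section Frobenius.
Variables (k L : fieldType).
Variables (iota : {rmorphism k -> L}) (sigma : {rmorphism L -> L}).
Hypothesis sigma_iota : forall a, sigma (iota a) = iota a.
Implicit Types X Y : projScheme k.

Fact frob_subproof X (P : points X iota) :
  on_scheme X iota (map_line sigma (val P)).
Proof.
by have := valP P; rewrite (on_scheme_map (j := iota)) //; case/andP: (valP P).
Qed.

Definition frob X (P : points X iota) : points X iota :=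
  Sub _ (frob_subproof P).

(** The factor [c] absorbs the discrepancy between the vector picked in the image line and the image
    of the picked vector. *)
Lemma hcoord_frob X (P : points X iota) : exists2 c, c != 0 &
  forall i, hcoord (val (frob P)) i = c * sigma (hcoord (val P) i).
Proof.
have /andP[/vline_vpick[v0 _] _] := valP P.
have [|c c0 def_w] := @vpick_vline _ _ (map_mx sigma (vpick (val P))).
  by rewrite map_mx_eq0.
by exists c => // i; rewrite /hcoord /= /map_line def_w !mxE.
Qed.

Lemma peval_frob X d (f : {mpoly k[(ambient X).+1]}) (P : points X iota) c :
    f \is d.-homog ->
    (forall i, hcoord (val (frob P)) i = c * sigma (hcoord (val P) i)) ->
  peval iota f (val (frob P)) = c ^+ d * sigma (peval iota f (val P)).
Proof.
move=> fd cP; rewrite /peval (dhomog_mevalZ iota fd cP).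
by congr (_ * _); apply/esym/rmorph_meval.
Qed.

(** Equations over [k] have coefficients fixed by [sigma], hence vanish at [P] if and only if they
    vanish at its Frobenius image. *)
Lemma zopen_frob X (W : points X iota -> Prop) P :
  zopen iota W -> W P -> W (frob P).
Proof.
case=> Z [fs fs_hom defZ] defW /defW nZP; apply/defW => /defZ ZfP.
apply/nZP/defZ => f fs_f; have [d fd] := fs_hom f fs_f.
have [c c0 cP] := hcoord_frob P; have /eqP := ZfP f fs_f.
rewrite (peval_frob fd cP) mulf_eq0 expf_eq0 (negPf c0) andbF fmorph_eq0.
by move/eqP.
Qed.

(** A neighbourhood of [P] open over [k] also contains [frob P], so the same polynomials over [k]
    compute [phi] at both points, and [sigma] commutes with them up to a scalar. *)
Lemma morphism_frob X Y (phi : points X iota -> points Y iota) :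
  morphism_over phi -> forall P, phi (frob P) = frob (phi P).
Proof.
move=> phi_mor P; have [W [d [g [Wopen WP g_hom gW]]]] := phi_mor P.
have [v0 phiP] := gW P WP; have [w0 phifP] := gW _ (zopen_frob Wopen WP).
apply: val_inj; rewrite phifP /= phiP map_line_vline //.
apply/esym/eqP/vline_eqP; first by rewrite map_mx_eq0.
have [c c0 cP] := hcoord_frob P; exists (c ^+ d); first by rewrite expf_neq0.
by apply/rowP => i; rewrite !mxE (peval_frob (g_hom i) cP).
Qed.

Hypothesis sigma_fix : forall x, sigma x = x -> exists a, x = iota a.

(** Scaling a coordinate to 1 forces the scalar relating the vector to its Frobenius image to be 1;
    every coordinate is then fixed by [sigma], hence lies in [k]. *)
Lemma frob_fixed_rational X (P : points X iota) : frob P = P ->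
  exists2 v : 'rV[k]_(ambient X).+1, v != 0 & val P = map_line iota <[v]>%VS.
Proof.
move=> /(congr1 val) fP; have {fP}: map_line sigma (val P) = val P by [].
have [v v0 ->] : exists2 v, v != 0 & val P = <[v]>%VS.
  by have /andP[/vline_vpick[v0 defP] _] := valP P; exists (vpick (val P)).
have /rV0Pn[i vi] := v0.
pose w := (v 0 i)^-1 *: v.
have w0 : w != 0 by rewrite scaler_eq0 negb_or invr_eq0 vi v0.
have -> : <[v]>%VS = <[w]>%VS.
  by apply/eqP/vline_eqP => //; exists (v 0 i)^-1; rewrite ?invr_eq0.
have wi : w 0 i = 1 by rewrite mxE mulVf.
rewrite map_line_vline // => /eqP/vline_eqP; rewrite map_mx_eq0.
move=> -[] // c _ cw.
have c1 : c = 1.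
  by have /rowP/(_ i) := cw; rewrite !mxE -/w mulVf // rmorph1 mulr1.
have /fin_all_exists[u uw] j : exists a, w 0 j = iota a.
  apply: sigma_fix; have /rowP/(_ j) := cw.
  by rewrite c1 scale1r [RHS]mxE.
have def_w : w = map_mx iota (\row_j u j).
  by apply/rowP => j; rewrite !mxE -uw mxE.
exists (\row_j u j); first by rewrite -(map_mx_eq0 iota) -def_w.
by rewrite map_line_vline -?def_w // -(map_mx_eq0 iota) -def_w.
Qed.

End Frobenius.

Lemma npoints_fixed (k : finFieldType) (L : fieldType)
    (iota : {rmorphism k -> L}) (sigma : {rmorphism L -> L})
    (sigma_iota : forall a, sigma (iota a) = iota a)
    (sigma_fix : forall x, sigma x = x -> exists a, x = iota a)
    (X : projScheme k) :
  exists s : seq (points X iota), [/\ uniq s, size s = npoints X &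
    forall P, P \in s <-> frob sigma_iota P = P].
Proof.
pose kpts := undup [seq P <- [seq <[v]>%VS | v : 'rV[k]_(ambient X).+1]
                   | on_scheme X (idfun : {rmorphism k -> k}) P].
have dim1 P : P \in kpts -> \dim P == 1%N.
  by rewrite mem_undup mem_filter => /andP[/andP[]].
have on_map P : P \in kpts -> on_scheme X iota (map_line iota P).
  move=> kP; rewrite (on_scheme_map (j := idfun)) ?dim1 //.
  by move: kP; rewrite mem_undup mem_filter => /andP[].
pose lpts := [seq map_line iota P | P <- kpts].
have lptsX : all (on_scheme X iota) lpts.
  by apply/allP => _ /mapP[P kP ->]; apply: on_map.
exists (pmap insub lpts : seq (points X iota)); split.
- apply: pmap_sub_uniq; rewrite map_inj_in_uniq ?undup_uniq // => P Q kP kQ.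
  by apply: map_line_inj; apply: dim1.
- rewrite size_pmap_sub; move: lptsX; rewrite all_count => /eqP->.
  by rewrite size_map.
move=> P; rewrite mem_pmap_sub; split=> [/mapP[Q kQ defP] | fP].
  apply/val_inj; change (map_line sigma (val P) = val P).
  rewrite defP; have [] := vline_vpick (dim1 _ kQ).
  move: (vpick Q) => v v0 ->.
  rewrite (map_line_vline iota v0) map_line_vline ?map_mx_eq0 //.
  by congr vline; apply/matrixP => i l; rewrite !mxE sigma_iota.
have [v v0 defP] := frob_fixed_rational sigma_fix fP.
apply/mapP; exists <[v]>%VS => //.
rewrite mem_undup mem_filter; apply/andP; split.
  have := valP P; rewrite defP (on_scheme_map (j := idfun)) //.
  by rewrite dim_vline v0.
by apply/mapP; exists v; rewrite ?mem_enum.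
Qed.

(** Take the [#|k|]-th power map, additive because [#|k|] is a power of the characteristic. Its
    fixed points are roots of ['X^#|k| - 'X], which is the product of the ['X - a] for [a] in
    [k]. *)
Lemma frobenius_exists (k : finFieldType) (L : fieldType)
    (iota : {rmorphism k -> L}) :
  exists sigma : {rmorphism L -> L}, (forall a, sigma (iota a) = iota a) /\
    (forall x, sigma x = x -> exists a, x = iota a).
Proof.
have [p p_pr pk] := finPcharP k.
have pL : p \in [pchar L] by rewrite (fmorph_pchar iota).
have q_nat : [pchar L].-nat #|k|.
  rewrite (eq_pnat _ (pcharf_eq pL)).
  by rewrite (card_pprimeChar pk) pnatX pnat_id.
pose fr (x : L) := x ^+ #|k|.
have fr_add : zmod_morphism fr.
  move=> x y; apply/eqP; rewrite eq_sym subr_eq; apply/eqP.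
  by rewrite /fr -exprDn_pchar // subrK.
have fr_mul : monoid_morphism fr by split=> [|x y]; rewrite /fr ?expr1n ?exprMn.
pose frA := GRing.isZmodMorphism.Build L L fr fr_add.
pose frM := GRing.isMonoidMorphism.Build L L fr fr_mul.
pose sigma : {rmorphism L -> L} := HB.pack fr frA frM.
exists sigma; split=> [a | x fx]; first by rewrite /= /fr -rmorphXn expf_card.
have: root (map_poly iota ('X^#|k| - 'X)) x.
  by rewrite rmorphB /= map_polyXn map_polyX rootE !hornerE [x ^+ _]fx subrr.
rewrite finField_genPoly rmorph_prod /= rootE horner_prod => /prodf_eq0.
case=> a _; rewrite rmorphB /= map_polyX map_polyC !hornerE subr_eq0 => /eqP.
by exists a.
Qed.

(** * Counting stable orbits *)

Lemma count_sum (I : Type) (p : pred I) s : count p s = (\sum_(x <- s) p x)%N.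
Proof.
by rewrite -sum1_count big_mkcond; apply: eq_bigr => x _; case: (p x).
Qed.

Section Counting.
Variables (gT : finGroupType) (T : eqType).
Variables (to : {action gT &-> T}) (F : T -> T).

Lemma act_injective : left_injective to.
Proof. by case: to => act /= act_to; case: act_to. Qed.

Lemma act_mul x g h : to x (g * h)%g = to (to x g) h.
Proof. by case: to => act /= act_to; case: act_to => _; apply; rewrite inE. Qed.

Hypothesis F_equivariant : forall x g, F (to x g) = to (F x) g.

(** A Burnside count twisted by [F]: each [F]-stable [H]-orbit contributes [#|H|] pairs [(x, h)]
    with [F x = to x h], and the other orbits contribute none. Defining [S] through the whole group
    lets the same list serve every [H]. *)
Lemma count_twisted (H : {group gT}) (U : eqType) (pi : T -> U)
    (FU : seq U) (S : seq T) :
    (forall u, exists x, pi x = u) ->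
    (forall x y, pi x = pi y <-> exists2 h, h \in H & y = to x h) ->
    uniq FU -> (forall x, pi x \in FU <-> pi (F x) = pi x) ->
    uniq S -> (forall x, x \in S <-> exists g, F x = to x g) ->
  (#|H| * size FU = \sum_(h in H) count (fun x => F x == to x h) S)%N.
Proof.
move=> pi_surj piP uniqFU FUP uniqS SP.
pose n x := (\sum_(h in H) (F x == to x h))%N.
(* If [pi x] is not in [FU], the orbit of [x] is not stable and [n x] is 0, so grouping points by
   their image in [FU] loses nothing. *)
have FU_n x : (\sum_(u <- FU) (pi x == u) * n x = n x)%N.
  rewrite -big_distrl /=.
  have -> : (\sum_(u <- FU) (pi x == u) = (pi x \in FU))%N.
    rewrite -(count_uniq_mem _ uniqFU) count_sum.
    by apply: eq_bigr => u _; rewrite eq_sym.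
  have [_|/negP nFU] := boolP (pi x \in FU); first by rewrite mul1n.
  rewrite mul0n /n big1 // => h hH; case: eqP => // Fx; case: nFU.
  by apply/FUP/esym/piP; exists h.
transitivity (\sum_(x <- S) n x)%N; last first.
  by rewrite exchange_big; apply: eq_bigr => h _; rewrite count_sum.
rewrite -(eq_bigr _ (fun x _ => FU_n x)) exchange_big /=.
transitivity (\sum_(u <- FU) #|H|)%N.
  by rewrite big_const_seq count_predT iter_addn_0.
apply: eq_big_seq => u FUu; have [x0 def_u] := pi_surj u.
have [h0 h0H Fx0] : exists2 h, h \in H & F x0 = to x0 h.
  by apply/piP/esym/FUP; rewrite def_u.
(* On the fibre of [u], an orbit of [H], the twisted stabilisers are
   reparametrised by the elements sending [x0] to [x]. *)
transitivity (\sum_(x <- S) \sum_(h in H) (to x0 h == x))%N; last first.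
  apply: eq_bigr => x _; have [def_x | xu] := eqVneq (pi x) u; last first.
    rewrite mul0n big1 // => h hH; case: eqP => // def_x; case/eqP: xu.
    by rewrite -def_u; apply/esym/piP; exists h.
  have [h1 h1H ->] : exists2 h, h \in H & x = to x0 h.
    by apply/piP; rewrite def_u.
  rewrite mul1n /n F_equivariant Fx0.
  (* Since [F x] is [x0] moved by [c], substituting [h^-1 * c] for [h] turns [F x = to x h] into
     [to x0 h = x]. *)
  pose c := (h0 * h1)%g.
  rewrite [RHS](reindex_inj (inj_comp (mulIg c) invg_inj)) /=.
  apply: eq_big => h; first by rewrite groupMr ?groupV // groupM.
  move=> _; rewrite -(inj_eq (@act_injective (h^-1 * c)%g)).
  by rewrite -!act_mul mulKVg.
rewrite exchange_big -sum1_card; apply: eq_bigr => h hH /=.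
transitivity (to x0 h \in S : nat).
  have -> // : to x0 h \in S.
  have pih : pi (to x0 h) = u by rewrite -def_u; apply/esym/piP; exists h.
  have /esym/piP[g _ Fx] : pi (F (to x0 h)) = pi (to x0 h).
    by apply/FUP; rewrite pih.
  by apply/SP; exists g.
rewrite -(count_uniq_mem _ uniqS) count_sum.
by apply: eq_bigr => x _; rewrite eq_sym.
Qed.

(** [T] may be infinite, but the fibres of [pi] are orbits of a finite group: one point is lifted
    above each element of [us], then moved by the whole group. *)
Lemma finite_preimage (U : eqType) (pi : T -> U) (us : seq U) :
    (forall u, exists x, pi x = u) ->
    (forall x y, pi x = pi y <-> exists g, y = to x g) ->
  exists2 S : seq T, uniq S & forall x, (x \in S) = (pi x \in us).
Proof.
move=> pi_surj piP.
have [xs ->] : exists xs, us = map pi xs.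
  elim: us => [|u us [xs ->]]; first by exists [::].
  by have [x <-] := pi_surj u; exists (x :: xs).
exists (undup [seq to x g | x <- xs, g <- enum gT]); first exact: undup_uniq.
move=> x; rewrite mem_undup.
apply/allpairsP/mapP => [[[y g] /= [yxs _ ->]] | [y yxs]].
  by exists y => //; apply/esym/piP; exists g.
by move=> /esym/piP[g ->]; exists (y, g); rewrite mem_enum.
Qed.
End Counting.

(** * Fourier analysis on an elementary abelian 2-group *)

Section Fourier.
Variable r : nat.
Local Notation V := 'rV['F_2]_r.
Implicit Types (u v w : V) (H : {group V}) (I K T : {set V}).

(** The standard bilinear form identifies the group with its dual, so [u] indexes all the
    characters. The exponent is an element of ['F_2] read as the natural number 0 or 1. *)
Definition chi u v : rat := (-1) ^+ (v *m u^T) 0 0.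

Lemma chiDr u v w : chi u (v + w) = chi u v * chi u w.
Proof. by rewrite /chi mulmxDl mxE -exprD /= modn2 signr_odd. Qed.

Lemma chiDl u v w : chi (u + v) w = chi u w * chi v w.
Proof. by rewrite /chi linearD mulmxDr mxE -exprD /= modn2 signr_odd. Qed.

Lemma chi0 u : chi u 0 = 1.
Proof. by rewrite /chi mul0mx mxE. Qed.

Lemma chi_indicator u v : (chi u v == 1)%:R = (1 + chi u v) / 2%:R.
Proof. by rewrite /chi -signr_odd; case: odd. Qed.

Lemma chi_sum u I : chi u (\sum_(v in I) v) = \prod_(v in I) chi u v.
Proof. by apply: (big_morph _ (chiDr u) (chi0 u)). Qed.

Definition chi_trivial u I := [forall v in I, chi u v == 1].

Lemma chi_trivialU u I K :
  chi_trivial u (I :|: K) = chi_trivial u I && chi_trivial u K.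
Proof.
apply/forall_inP/andP => [tIK | [/forall_inP tI /forall_inP tK] v].
  by split; apply/forall_inP => v vI; rewrite tIK // inE vI ?orbT.
by case/setUP; [apply: tI | apply: tK].
Qed.

Lemma chi_trivial_prod u I :
  (chi_trivial u I)%:R = \prod_(v in I) (chi u v == 1)%:R :> rat.
Proof.
have [/forall_inP tI | /forall_inPn[v vI /negPf v1]] := boolP (chi_trivial u I).
  by rewrite big1 // => v /tI->.
by rewrite (bigD1 v) //= v1 mul0r.
Qed.

Lemma chi_trivial_gen u I : chi_trivial u <<I>>%g = chi_trivial u I.
Proof.
apply/forall_inP/forall_inP => [tI v vI | tI v /gen_prodgP[n [c cI ->]]].
  by rewrite tI ?mem_gen.
elim/big_ind: _ => [|x y /eqP x1 /eqP y1|i _]; [by rewrite chi0 | | exact: tI].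
by rewrite FinRing.zmodMgE chiDr x1 y1.
Qed.

(** If [chi u v] is not 1 for some [v] in [H], translation by [v] multiplies the sum by [chi u v]
    while leaving it unchanged, so it vanishes. *)
Lemma sum_chi_group u H :
  \sum_(h in H) chi u h = #|H|%:R * (chi_trivial u H)%:R.
Proof.
have [/forall_inP tH | /forall_inPn[v vH v1]] := boolP (chi_trivial u H).
  by rewrite mulr1 -sumr_const; apply: eq_bigr => h /tH/eqP.
have shift : \sum_(h in H) chi u h = chi u v * \sum_(h in H) chi u h.
  rewrite [LHS](reindex_inj (addrI v)) mulr_sumr.
  by apply: eq_big => h; [apply: (groupMl h vH) | rewrite chiDr].
have /eqP : (chi u v - 1) * \sum_(h in H) chi u h = 0.
  by rewrite mulrBl mul1r -shift subrr.
by rewrite mulr0 mulf_eq0 subr_eq0 (negPf v1) => /eqP.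
Qed.

(** The same translation argument on the dual side: if [v] has a nonzero coordinate [i], shifting
    [u] by the [i]-th unit vector changes the sign of the sum. *)
Lemma sum_chi_dual v : \sum_u chi u v = (2 ^ r)%:R * (v == 0)%:R.
Proof.
have [-> | /rV0Pn[i vi]] := eqVneq v 0.
  rewrite (eq_bigr (fun=> 1)) => [|u _]; rewrite ?chi0 // sumr_const.
  by rewrite card_mx card_Fp // mul1n mulr1.
have chi_v : chi (delta_mx 0 i) v = -1.
  have -> : chi (delta_mx 0 i) v = (-1) ^+ (v 0 i).
    by rewrite /chi trmx_delta -colE mxE.
  by case: (v 0 i) vi => -[|[|]].
set S := \sum_u _; suff: S *+ 2 == 0 by rewrite mulr0 mulrn_eq0 => /eqP.
rewrite mulr2n addr_eq0; apply/eqP.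
rewrite [LHS](reindex_inj (addrI (delta_mx 0 i))) -sumrN; apply: eq_bigr => u _.
by rewrite chiDl chi_v mulN1r.
Qed.

Lemma chi_orthogonality v w :
  \sum_u chi u v * chi u w = (2 ^ r)%:R * (v == w)%:R.
Proof.
under eq_bigr => u _ do rewrite -chiDr.
rewrite sum_chi_dual addr_eq0; congr (_ * (_ == _)%:R).
by rewrite -scaleN1r (_ : -1 = 1) ?scale1r //; apply/val_inj.
Qed.

Lemma fourier_inversion (f : V -> rat) v :
  f v = \sum_u ((2 ^ r)%:R^-1 * \sum_w f w * chi u w) * chi u v.
Proof.
under eq_bigr => u _ do rewrite -mulrA mulr_suml.
rewrite -mulr_sumr exchange_big /=.
under eq_bigr => w _ do
  (under eq_bigr => u _ do rewrite -mulrA;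
   rewrite -mulr_sumr chi_orthogonality).
rewrite (bigD1 v) //= eqxx big1 => [|w /negPf->]; last by rewrite !mulr0.
by rewrite addr0 mulr1 mulrCA mulVf ?mulr1 // pnatr_eq0 expn_eq0.
Qed.

(** This is the required identity for a single character, doubled to clear the denominator in
    [[x = 1] = (1 + x) / 2] for a sign [x]; the term for empty [I] is still included. *)
Lemma chi_trivial_double u T K :
  2 * (chi_trivial u ([set (\sum_(v in T) v)%R] :|: K))%:R =
  (chi_trivial u K)%:R + (-1) ^+ #|T| * \sum_(I : {set V} | I \subset T)
     (- 2) ^+ #|I| * (chi_trivial u (I :|: K))%:R :> rat.
Proof.
have expand : \prod_(v in T) chi u v = (-1) ^+ #|T| *
    \sum_(I : {set V} | I \subset T) (- 2) ^+ #|I| * (chi_trivial u I)%:R.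
  (* Extracting the signs leaves factors [1 - 2 [chi u v = 1]], whose product expands over subsets.
     Padding with factors [0 + 1] outside [T] makes the product range over all [v], and subsets not
     contained in [T] then contribute 0. *)
  rewrite (eq_bigr (fun v => -1 * - chi u v)) => [|v _]; last first.
    by rewrite mulN1r opprK.
  rewrite prodrMl; congr (_ * _).
  transitivity
    (\prod_v ((if v \in T then - 2 * (chi u v == 1)%:R else 0) + 1 : rat)).
    rewrite [LHS]big_mkcond; apply: eq_bigr => v _.
    case: ifP => _; last by rewrite add0r.
    by rewrite chi_indicator mulNr mulrC divfK // opprD addrAC addNr add0r.
  rewrite bigA_distr [RHS]big_mkcond; apply: eq_bigr => I _ /=.
  rewrite -big_mkcond.
  have [/subsetP IT | /subsetPn[v vI vT]] := boolP (I \subset T).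
    by rewrite chi_trivial_prod -prodrMl; apply: eq_bigr => v /IT->.
  by rewrite (bigD1 v) //= (negPf vT) mul0r.
rewrite chi_trivialU.
under [X in _ + _ * X]eq_bigr => I _ do
  rewrite chi_trivialU -mulnb natrM mulrA.
rewrite -mulr_suml mulrA -expand -mulnb natrM mulrA.
rewrite chi_trivial_prod big_set1 chi_indicator chi_sum mulrCA mulfV // mulr1.
by rewrite mulrDl mul1r.
Qed.

(** * Set functions given by averages over generated subgroups *)

Variables (N : {set V} -> nat) (f : V -> nat).
Hypothesis N_avg : forall I, (#|<<I>>%g| * N I = \sum_(h in <<I>>%g) f h)%N.

Lemma N_fourier : exists c : V -> rat,
  forall I, (N I)%:R = \sum_u c u * (chi_trivial u I)%:R.
Proof.
(* The witness is fixed by the final unification as the Fourier transform of [f]. Introduced before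
   [I], it cannot depend on [I]. *)
eexists => I; have H0 : #|<<I>>%g|%:R != 0 :> rat.
  by rewrite pnatr_eq0 -lt0n cardG_gt0.
apply: (mulfI H0); rewrite -natrM N_avg natr_sum.
under eq_bigr => h _ do rewrite (fourier_inversion (fun g => (f g)%:R)).
rewrite exchange_big mulr_sumr; apply: eq_bigr => u _ /=.
by rewrite -mulr_sumr sum_chi_group chi_trivial_gen mulrCA.
Qed.

Lemma N_double T K :
  2 * (N ([set (\sum_(v in T) v)%R] :|: K))%:R =
  (N K)%:R + (-1) ^+ #|T| *
    \sum_(I : {set V} | I \subset T) (- 2) ^+ #|I| * (N (I :|: K))%:R :> rat.
Proof.
have [c Nc] := N_fourier; rewrite !Nc.
under [X in _ + _ * X]eq_bigr => I _ do rewrite Nc mulr_sumr.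
rewrite exchange_big /= !mulr_sumr -big_split; apply: eq_bigr => u _ /=.
rewrite mulrCA chi_trivial_double mulrDr; congr (_ + _).
rewrite mulrCA; congr (_ * _).
by rewrite mulr_sumr; apply: eq_bigr => I _; rewrite mulrCA.
Qed.

(** Halve [N_double] after splitting off the empty set, which supplies the second half of the
    coefficient of [N K]. For nonempty [I], half of [(- 2) ^+ #|I|] is [- (- 2) ^+ #|I|.-1], whence
    the exponent [#|T|.+1] of the sign. *)
Lemma N_sum T K :
  (N ([set (\sum_(v in T) v)%R] :|: K))%:R =
  (1 + (-1) ^+ #|T|) / 2 * (N K)%:R + (-1) ^+ #|T|.+1 *
    \sum_(I : {set V} | (I \subset T) && (I != set0))
       (- 2) ^+ #|I|.-1 * (N (I :|: K))%:R :> rat.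
Proof.
have two0 : 2 != 0 :> rat by [].
apply: (mulfI two0); rewrite N_double (bigD1 set0) ?sub0set //=.
rewrite cards0 expr0 mul1r set0U !mulrDr addrA -[X in X + _ + _]mul1r -mulrDl.
congr (_ + _).
  by rewrite mulrA mulrCA mulfV ?mulr1.
rewrite mulrCA exprSr -mulrA; congr (_ * _); rewrite mulN1r mulr_sumr -sumrN.
apply: eq_bigr => I /andP[_]; rewrite -cards_eq0.
by case: #|I| => // n _; rewrite exprS /= -!mulrA mulNr.
Qed.

(** The only fraction, [(1 + (-1) ^+ #|T|) / 2], is 1 or 0 according to the parity of [#|T|], so the
    identity holds over the integers. *)
Lemma N_sum_int T K :
  (N ([set (\sum_(v in T) v)%R] :|: K))%:Z =
  (~~ odd #|T|)%:Z * (N K)%:Z + (-1) ^+ #|T|.+1 *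
    \sum_(I : {set V} | (I \subset T) && (I != set0))
       (- 2) ^+ #|I|.-1 * (N (I :|: K))%:Z.
Proof.
apply: (@intr_inj rat); rewrite -pmulrn N_sum rmorphD !rmorphM /= rmorph_sum.
rewrite -!pmulrn; congr (_ * _ + _ * _); last 1 first.
- by apply: eq_bigr => I _; rewrite rmorphM rmorphXn.
- by rewrite -signr_odd; case: odd.
by rewrite rmorphXn rmorphN1.
Qed.

Lemma N_span (B : {set V}) :
    (forall v, exists2 T : {set V}, T \subset B & v = \sum_(w in T) w) ->
  forall I, exists c : {set V} -> int,
    (N I)%:Z = \sum_(S : {set V} | S \subset B) c S * (N S)%:Z.
Proof.
move=> span_B.
pose span (z : int) := exists c : {set V} -> int,
  z = \sum_(S : {set V} | S \subset B) c S * (N S)%:Z.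
have span0 : span 0 by exists (fun=> 0); rewrite big1 // => S _; rewrite mul0r.
have spanD x y : span x -> span y -> span (x + y).
  move=> [c ->] [d ->]; exists (fun S => c S + d S).
  by rewrite -big_split; apply: eq_bigr => S _; rewrite mulrDl.
have spanM a x : span x -> span (a * x).
  move=> [c ->]; exists (fun S => a * c S); rewrite mulr_sumr.
  by apply: eq_bigr => S _; rewrite mulrA.
(* The part [J] already inside [B] is carried along: replacing [v] in [I] by subsets [L] of [T]
   enlarges only [J], so the size of the remaining part drops by one. *)
suffices spanU n (I J : {set V}) :
    #|I| = n -> J \subset B -> span (N (I :|: J))%:Z.
  by move=> I; rewrite -(setU0 I); apply: spanU (erefl _) (sub0set B).
elim: n I J => [|n IHn] I J.
  move=> /eqP; rewrite cards_eq0 => /eqP-> JB; rewrite set0U.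
  exists (fun S => (S == J)%:R); rewrite (bigD1 J) //= eqxx mul1r.
  rewrite big1 ?addr0 //.
  by move=> S /andP[_ /negPf->]; rewrite mul0r.
move=> cardI JB; have /card_gt0P[v vI] : (0 < #|I|)%N by rewrite cardI.
have cardIv : #|I :\ v| = n by move: cardI; rewrite (cardsD1 v) vI => -[].
rewrite -(setD1K vI) -setUA; have [T TB def_v] := span_B v.
rewrite {1}def_v N_sum_int; apply/spanD; apply/spanM; first exact: IHn.
apply: (big_ind span span0 spanD) => L /andP[LT _].
apply/spanM; rewrite setUCA.
by apply: IHn; rewrite // subUset (subset_trans LT).
Qed.
End Fourier.

(** * Point counts of the quotient curves *)

Theorem corollaryA7 (k : finFieldType) (L : closedFieldType)
    (iota : {rmorphism k -> L}) (L_algebraic : integralRange iota)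
    (X : curve iota) (r : nat)
    (to : {action 'rV['F_2]_r &-> cpoints X})
    (to_morphism : forall g, morphism_over (fun x => to x g))
    (XmodH : forall H : {group 'rV['F_2]_r}, quotient_curve to H)
    (b : r.-tuple 'rV['F_2]_r) (b_basis : basis_of {: 'rV['F_2]_r} b) :
  let N (I : {set 'rV['F_2]_r}) : nat := npoints (XmodH <<I>>%G) in
  let B (s : nat) : {set 'rV['F_2]_r} :=
    [set tnth b i | i : 'I_r & (i < s)%N] in
  (forall (K : {set 'rV['F_2]_r}) (s : nat), (s <= r)%N ->
     (N ([set (\sum_(i < r | (i < s)%N) tnth b i)%R] :|: K))%:R =
       (1 + (-1) ^+ s) / 2%:R * (N K)%:R +
       (-1) ^+ s.+1 *
         \sum_(1 <= j < s.+1) (- 2%:R) ^+ (j - 1)%N *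
           \sum_(I : {set 'rV['F_2]_r} | (I \subset B s) && (#|I| == j))
             (N (I :|: K))%:R :> rat) /\
  (forall I : {set 'rV['F_2]_r}, exists c : {set 'rV['F_2]_r} -> int,
     (N I)%:Z = \sum_(S : {set 'rV['F_2]_r} | S \subset B r) c S * (N S)%:Z).
Proof.
move=> N B.
have [sigma [sigma_iota sigma_fix]] := frobenius_exists iota.
pose XmodG := XmodH [set: 'rV['F_2]_r]%G.
have fixedP Y := npoints_fixed sigma_iota sigma_fix Y.
have F_to x g : frob sigma_iota (to x g) = to (frob sigma_iota x) g.
  by apply/esym/(morphism_frob sigma_iota (to_morphism g)).
have F_pi H x : frob sigma_iota (quot_map (XmodH H) x) =
    quot_map (XmodH H) (frob sigma_iota x).
  by apply/esym/(morphism_frob sigma_iota (quot_morphism (XmodH H))).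
(* The points above the rational points of the quotient by the whole group are those [x] with [F x]
   in the orbit of [x]. They form a finite list [S], so that a single [f] is valid for all
   subgroups. *)
have [FG [uniqFG _ FGP]] := fixedP XmodG.
have [|x y|S uniqS SP] := @finite_preimage _ _ to _ (quot_map XmodG) FG.
- exact: quot_surj.
- rewrite (quot_orbits XmodG); split=> [[g _ ->] | [g ->]]; exists g => //.
pose f g := count (fun x => frob sigma_iota x == to x g) S.
have N_avg I : (#|<<I>>%g| * N I = \sum_(h in <<I>>%g) f h)%N.
  have [FH [uniqFH sizeFH FHP]] := fixedP (XmodH <<I>>%G).
  rewrite /N -sizeFH.
  apply: (@count_twisted _ _ to _ _ _ _ (quot_map (XmodH <<I>>%G))) => //.
  - exact: quot_surj.
  - exact: quot_orbits.
  - by move=> x; rewrite FHP F_pi.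
  move=> x; rewrite SP FGP F_pi; split=> [/esym/quot_orbits[g _]|[g]] Fx.
    by exists g.
  by apply/esym/quot_orbits; exists g; rewrite ?inE.
have tnth_inj : injective (tnth b).
  by apply/tuple_uniqP/free_uniq/(basis_free b_basis).
have card_B s : (s <= r)%N -> #|B s| = s.
  move=> sr; rewrite card_imset // -sum1_card.
  rewrite (eq_bigl (fun i : 'I_r => i < s)%N).
    by rewrite (big_ord_narrow sr) big_const_ord iter_addn_0 mul1n.
  by move=> i; rewrite inE.
split=> [K s sr | ]; last first.
  apply: (N_span N_avg) => v.
  (* Coordinates in ['F_2] are 0 or 1, so [v] is the sum of the basis vectors at which its
     coordinate is nonzero. *)
  exists [set tnth b i | i : 'I_r & coord b i v != 0].
    by apply: imsetS; apply/subsetP => i _; rewrite !inE ltn_ord.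
  rewrite big_imset /=; last by move=> i j _ _; apply: tnth_inj.
  rewrite {1}(coord_basis b_basis (memvf v)) [RHS]big_mkcond.
  apply: eq_bigr => i _; rewrite inE -tnth_nth.
  have [-> | c0] := eqVneq (coord b i v) 0; first by rewrite scale0r.
  suff -> : coord b i v = 1 by rewrite scale1r.
  by move: (coord b i v) c0 => -[[|[|]] //] ? _; apply/val_inj.
have -> : \sum_(i < r | (i < s)%N) tnth b i = \sum_(v in B s) v.
  rewrite big_imset /=; last by move=> i j _ _; apply: tnth_inj.
  by apply: eq_bigl => i; rewrite inE.
rewrite (N_sum N_avg) (card_B s sr); congr (_ + _ * _).
under [RHS]eq_bigr => j _ do rewrite mulr_sumr.
(* Once the sums are exchanged, each [I] meets only the index [j = #|I|]. It lies in the range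
   exactly when [I] is nonempty, the upper bound [s] being the size of [B s]. *)
rewrite (exchange_big_dep (fun I : {set _} => I \subset B s)) /=; last first.
  by move=> j I _ /andP[].
rewrite [LHS]big_mkcondr; apply: eq_bigr => I IB.
under eq_bigl => j do rewrite IB eq_sym.
have sI : (#|I| < s.+1)%N by rewrite ltnS -(card_B s sr) subset_leq_card.
by rewrite big_nat1_eq sI andbT -card_gt0 subn1.
Qed.
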